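(* Let $G$ be a connected $(P_5,2K_1\cup K_2)$-free graph. Then $cop(G)\leq 2$.
   Context: All graphs are finite, simple and undirected. $P_n$ and $K_n$ denote the path and complete graph on $n$ vertices; $G\cup H$ denotes the disjoint union and $rG$ the disjoint union of $r$ copies of $G$, so $2K_1\cup K_2$ is an edge plus two isolated vertices. A graph is $(H_1,\dots,H_k)$-free if it contains no induced subgraph isomorphic to any $H_i$. Game of cops and robber on a connected graph: first all cops are placed on vertices (several may share a vertex), then the robber chooses a vertex; afterwards cops and robber move alternately, starting with the cops, a move consisting of staying put or moving to an adjacent vertex. The cops win if after finitely many rounds some cop is on the same vertex as the robber. The cop number $cop(G)$ is the minimum number of cops that guarantees a win in each connected component of $G$. *)

(* Defs.v *)
From mathcomp Require Import all_boot.
From mathcomp Require Import boolp.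

Set Implicit Arguments.
Unset Strict Implicit.
Unset Printing Implicit Defensive.

Record sgraph := SGraph {
  vertex :> finType;
  adj : rel vertex;
  adj_sym : symmetric adj;
  adj_irrefl : irreflexive adj
}.

Section StandardGraphs.
Variable n : nat.

Definition path_adj : rel 'I_n := fun i j => (i.+1 == j :> nat) || (j.+1 == i :> nat).

Lemma path_adj_sym : symmetric path_adj.
Proof. by move=> i j; rewrite /path_adj orbC. Qed.

Lemma path_adj_irrefl : irreflexive path_adj.
Proof. by move=> i; rewrite /path_adj orbb gtn_eqF. Qed.

Definition path_graph : sgraph := SGraph path_adj_sym path_adj_irrefl.

Definition complete_adj : rel 'I_n := fun i j => i != j.

Lemma complete_adj_sym : symmetric complete_adj.
Proof. by move=> i j; rewrite /complete_adj eq_sym. Qed.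

Lemma complete_adj_irrefl : irreflexive complete_adj.
Proof. by move=> i; rewrite /complete_adj eqxx. Qed.

Definition complete_graph : sgraph := SGraph complete_adj_sym complete_adj_irrefl.

End StandardGraphs.

Section DisjointUnion.
Variables G H : sgraph.

Definition union_adj : rel (G + H)%type := fun u v =>
  match u, v with
  | inl x, inl y => adj x y
  | inr x, inr y => adj x y
  | _, _ => false
  end.

Lemma union_adj_sym : symmetric union_adj.
Proof. by case=> x [] y //=; apply: adj_sym. Qed.

Lemma union_adj_irrefl : irreflexive union_adj.
Proof. by case=> x /=; apply: adj_irrefl. Qed.

Definition disjoint_union : sgraph := SGraph union_adj_sym union_adj_irrefl.

End DisjointUnion.

Section Copies.
Variables (r : nat) (G : sgraph).

Definition copies_adj : rel ('I_r * G)%type :=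
  fun u v => (u.1 == v.1) && adj u.2 v.2.

Lemma copies_adj_sym : symmetric copies_adj.
Proof. by move=> u v; rewrite /copies_adj eq_sym adj_sym. Qed.

Lemma copies_adj_irrefl : irreflexive copies_adj.
Proof. by move=> u; rewrite /copies_adj adj_irrefl andbF. Qed.

Definition copies : sgraph := SGraph copies_adj_sym copies_adj_irrefl.

End Copies.

Definition has_induced (G H : sgraph) : Prop :=
  exists f : H -> G, injective f /\ forall u v, adj (f u) (f v) = adj u v.

Definition free_of (G H : sgraph) : Prop := ~ has_induced G H.

Definition connected_graph (G : sgraph) : Prop :=
  forall x y : G, connect (@adj G) x y.

Section Game.
Variable G : sgraph.

Definition move (x y : G) : Prop := y = x \/ adj x y.

(* A strategy for k cops gives their positions as a function of the sequence of
   robber positions seen so far, oldest first; its value on [::] is the initial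
   placement. The cops' own past positions are determined by that sequence. *)
Definition strategy (k : nat) := seq G -> 'I_k -> G.

Definition legal_strategy k (s : strategy k) : Prop :=
  forall (h : seq G) (y : G) (i : 'I_k), move (s h i) (s (rcons h y) i).

Definition robber_walk (r : nat -> G) : Prop :=
  forall n, move (r n) (r n.+1).

Definition caught k (c : 'I_k -> G) (y : G) : Prop := exists i, c i = y.

(* When the robber has just reached r n, the cops stand at s (mkseq r n); they
   then move to s (mkseq r n.+1) while the robber is still at r n. *)
Definition cops_catch k (s : strategy k) (r : nat -> G) : Prop :=
  exists n, caught (s (mkseq r n)) (r n) \/ caught (s (mkseq r n.+1)) (r n).

(* k cops can guarantee a win on the connected component of x. Moves follow
   edges, so it is enough to constrain the starting positions. *)
Definition cops_win_component (k : nat) (x : G) : Prop :=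
  exists s : strategy k,
    [/\ legal_strategy s,
        forall i, connect (@adj G) x (s [::] i)
      & forall r : nat -> G, robber_walk r -> connect (@adj G) x (r 0) ->
          cops_catch s r].

Definition cops_suffice (k : nat) : Prop := forall x : G, cops_win_component k x.

Lemma cops_suffice_card : cops_suffice #|G|.
Proof.
move=> x.
pose c (i : 'I_#|G|) :=
  if connect (@adj G) x (enum_val i) then enum_val i else x.
exists (fun _ => c); split=> [h y i|i|r _ xr]; first by left.
  by rewrite /c; case: ifP => // _; apply: connect0.
exists 0; left; exists (enum_rank (r 0)).
by rewrite /c enum_rankK xr.
Qed.

Lemma ex_cops_suffice : exists k, `[< cops_suffice k >].
Proof. by exists #|G|; apply/asboolP/cops_suffice_card. Qed.

Definition cop_number : nat := ex_minn ex_cops_suffice.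

End Game.

(* Main.v *)
Require Import Defs.
From mathcomp Require Import all_boot.
From mathcomp Require Import boolp.

(** If some pair of vertices is dominating, or if the non-neighbours of some
    vertex [x] are independent, two cops win at once: in the second case a cop
    at [x] freezes the robber.  Otherwise [G] has no induced 2K_2: for edges
    [ab], [cd] with nothing between them, a common non-neighbour [t] of [a] and
    [c] is adjacent to [b] and [d] by (2K_1 + K_2)-freeness, so [a b t d c] is a
    P_5.  Hence every edge dominates all vertices but at most one.  Start the
    cops on non-adjacent [x], [y], with the robber at [r], so that [x], [y], [r]
    are independent.  The cop at [x] never moves; the other one goes to some [s]
    adjacent to [x] and [y] but not to [r], which freezes the robber, and then
    to some [t] adjacent to [x], [s] and [r] but not to [y].  Now [y] is the
    only undominated vertex, and the robber cannot reach it. *)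

Set Implicit Arguments.
Unset Strict Implicit.
Unset Printing Implicit Defensive.

(** * Positions won by the cops in a bounded number of moves *)

Section Force.
Variables (G : sgraph) (k : nat).
Implicit Types (c : 'I_k -> G) (r : G).

Definition cops_move c c' : Prop := forall i, move (c i) (c' i).

(** The cops are to move and may make [n] more moves; a capture counts before or right after a cops'
    move, as in [cops_catch]. *)
Fixpoint cops_force (n : nat) c r : Prop :=
  caught c r \/
  if n is m.+1 then
    exists c', cops_move c c' /\
      (caught c' r \/ forall r', move r r' -> cops_force m c' r')
  else False.

Definition good_reply (n : nat) c r c' : Prop :=
  cops_move c c' /\
  (caught c' r \/ forall r', move r r' -> cops_force n c' r').

(** A strategy is a function, so winning replies are selected by [choice]. Where no good reply
    exists the cops stay put, so that [reply] is always legal. *)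
Lemma good_reply_choice : exists reply : nat -> ('I_k -> G) -> G -> 'I_k -> G,
  forall n c r, cops_move c (reply n c r) /\
    (cops_force n.+1 c r -> caught c r \/ good_reply n c r (reply n c r)).
Proof.
have H (p : nat * ('I_k -> G) * G) : exists c',
    cops_move p.1.2 c' /\ (cops_force p.1.1.+1 p.1.2 p.2 ->
      caught p.1.2 p.2 \/ good_reply p.1.1 p.1.2 p.2 c').
  case: p => -[n c] r /=.
  have [[c' gc']|no] := pselect (exists c', good_reply n c r c').
    by exists c'; split; [case: gc' | move=> _; right].
  exists c; split; first by left.
  by case=> [|[c' gc']]; [left | case: no; exists c'].
have [f fP] := choice H.
by exists (fun n c r => f (n, c, r)) => n c r; apply: (fP (n, c, r)).
Qed.

Lemma cops_force_suffice (n : nat) c :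
  connected_graph G -> (forall r, cops_force n c r) -> cops_suffice G k.
Proof.
move=> Gconn force0 x.
have [reply replyP] := good_reply_choice.
pose step (st : nat * ('I_k -> G)) r :=
  if st.1 is m.+1 then (m, reply m st.2 r) else st.
have stepM st r : cops_move st.2 (step st r).2.
  by case: st => [[|m] c'] /=; [left | case: (replyP m c' r)].
(* The folded state is the number of moves left and the cops' positions; once the counter is 0 the
   cops stand still. *)
pose s : strategy G k := fun h => (foldl step (n, c) h).2.
exists s; split=> [h y i|i|r rwalk _]; [|exact: Gconn|].
  by rewrite /s -cats1 foldl_cat /=; apply: stepM.
(* Splitting off the first robber position leaves the same game on the shifted walk, with one move
   fewer. *)
have mkseqS (u : nat -> G) m : mkseq u m.+1 = u 0 :: mkseq (fun i => u i.+1) m.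
  by rewrite /mkseq /= (iotaDl 1 0 m) -map_comp.
have {force0} := force0 (r 0); rewrite /cops_catch /s.
elim: n c r rwalk {s} => [|n IHn] c' r rwalk.
  by case=> // cr; exists 0; left.
case: (replyP n c' (r 0)) => _ good force.
have [cr|[_ [cr|next]]] := good force.
- by exists 0; left.
- by exists 0; right.
have [|m catch] := IHn (reply n c' (r 0)) (fun i => r i.+1) _ (next _ (rwalk 0)).
  by move=> i; apply: rwalk.
by exists m.+1; rewrite !(mkseqS r).
Qed.

End Force.

(** * Play with two cops *)

Section TwoCops.
Variable G : sgraph.
Implicit Types a b c d r s t u v w x y z : G.

Definition pair_cops a b : 'I_2 -> G := fun i => if i == ord0 then a else b.

Lemma caught_pairl a b : caught (pair_cops a b) a.
Proof. by exists ord0. Qed.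

Lemma caught_pairr a b : caught (pair_cops a b) b.
Proof. by exists ord_max. Qed.

Lemma cops_move_pairr a b b' :
  adj b b' -> cops_move (pair_cops a b) (pair_cops a b').
Proof. by move=> bb' i; rewrite /pair_cops; case: ifP; [left | right]. Qed.

Lemma cops_move_pairl a a' b :
  adj a a' -> cops_move (pair_cops a b) (pair_cops a' b).
Proof. by move=> aa' i; rewrite /pair_cops; case: ifP; [right | left]. Qed.

Definition far x y := (x != y) && ~~ adj x y.

Lemma farC x y : far x y = far y x.
Proof. by rewrite /far eq_sym adj_sym. Qed.

Lemma far_neq x y : far x y -> x != y.
Proof. by case/andP. Qed.

Lemma far_nadj x y : far x y -> adj x y = false.
Proof. by case/andP=> _ /negbTE. Qed.

Lemma adj_far x y : adj x y -> far x y = false.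
Proof. by rewrite /far => ->; rewrite andbF. Qed.

Lemma nfarP x y : far x y = false -> x = y \/ adj x y.
Proof.
by move/negbT; rewrite negb_and !negbK => /orP[/eqP|]; [left | right].
Qed.

Lemma adj_neq x y : adj x y -> x != y.
Proof. by apply: contraTneq => ->; rewrite adj_irrefl. Qed.

(** A robber that is not far from some cop is captured by the next move. *)
Lemma cops_force_pair n a b r :
  (far a r -> far b r -> cops_force n.+1 (pair_cops a b) r) ->
  cops_force n.+1 (pair_cops a b) r.
Proof.
move=> H; case far_a: (far a r).
  case far_b: (far b r); first exact: H.
  case: (nfarP far_b) => [<-|br]; first by left; apply: caught_pairr.
  right; exists (pair_cops a r); split; first exact: cops_move_pairr.
  by left; apply: caught_pairr.
case: (nfarP far_a) => [<-|ar]; first by left; apply: caught_pairl.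
right; exists (pair_cops r b); split; first exact: cops_move_pairl.
by left; apply: caught_pairl.
Qed.

Lemma cops_force_step n a b b' r : adj b b' ->
  (forall r', move r r' -> far a r' -> far b' r' ->
     cops_force n.+1 (pair_cops a b') r') ->
  cops_force n.+2 (pair_cops a b) r.
Proof.
move=> bb' H; right; exists (pair_cops a b').
split; first exact: cops_move_pairr.
by right=> r' rr'; apply: cops_force_pair; apply: H.
Qed.

Definition dominating x y := forall z, ~~ (far x z && far y z).

Lemma dominating_win x y :
  connected_graph G -> dominating x y -> cops_suffice G 2.
Proof.
move=> Gconn dom; apply: (@cops_force_suffice G 2 1 (pair_cops x y)) => // r.
by apply: cops_force_pair => xr yr; move: (dom r); rewrite xr yr.
Qed.

Lemma connected_neighbour x y :
  connected_graph G -> x != y -> exists z, adj x z.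
Proof.
move=> Gconn xy; case/connectP: (Gconn x y) => -[|z p] /=.
  by move=> _ yx; rewrite yx eqxx in xy.
by case/andP=> xz _ _; exists z.
Qed.

Lemma independent_far_win x : connected_graph G ->
  (forall u v, far x u -> far x v -> ~~ adj u v) -> cops_suffice G 2.
Proof.
move=> Gconn ind; apply: (@cops_force_suffice G 2 2 (pair_cops x x)) => // r.
apply: cops_force_pair => xr _.
have frozen z : adj r z -> far x z = false.
  by move=> rz; apply/negP=> xz; move: (ind _ _ xr xz); rewrite rz.
have [e re] : exists e, adj r e.
  by apply: (@connected_neighbour _ x) => //; rewrite eq_sym far_neq.
(* The neighbour [e] of [r] is also adjacent to [x], so one cop steps to [e] while the other guards
   every exit of [r]. *)
case: (nfarP (frozen _ re)) => [xe|xe].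
  by move: (far_nadj xr); rewrite adj_sym xe re.
apply: (cops_force_step xe) => r' [->|/frozen ->] // _.
by rewrite farC adj_far.
Qed.

Hypothesis GfreeP5 : free_of G (path_graph 5).
Hypothesis Gfree2K1K2 : free_of G
  (disjoint_union (copies 2 (complete_graph 1)) (complete_graph 2)).

Lemma no_2K1K2 x y u v : far x y -> adj u v ->
  far x u -> far x v -> far y u -> far y v -> False.
Proof.
move=> xy uv xu xv yu yv; apply: Gfree2K1K2.
pose f (p : ('I_2 * 'I_1) + 'I_2) : G :=
  match p with
  | inl (i, _) => if i == ord0 then x else y
  | inr i => if i == ord0 then u else v
  end.
have E := (far_nadj xy, far_nadj xu, far_nadj xv, far_nadj yu, far_nadj yv).
have N := (negbTE (far_neq xy), negbTE (far_neq xu), negbTE (far_neq xv),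
           negbTE (far_neq yu), negbTE (far_neq yv), negbTE (adj_neq uv)).
have ordP (i : 'I_2) : i = ord0 \/ i = ord_max.
  by case: i => -[|[|//]] lt_i; [left | right]; apply: val_inj.
exists f; split.
  case=> [[i i']|i] [[j j']|j] /=; rewrite ?(ord1 i') ?(ord1 j');
  by case: (ordP i) (ordP j) => -> [] -> //= /eqP;
     rewrite ?N // eq_sym ?N.
case=> [[i i']|i] [[j j']|j] /=; rewrite /copies_adj /complete_adj
    /= ?(ord1 i') ?(ord1 j');
by case: (ordP i) (ordP j) => -> [] -> //=;
   rewrite ?adj_irrefl ?E ?uv // adj_sym ?E ?uv.
Qed.

Lemma no_P5 a b c d t : adj a b -> adj b t -> adj t d -> adj d c ->
  far a t -> far a d -> far a c -> far b d -> far b c -> far t c -> False.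
Proof.
move=> ab bt td dc at' ad ac bd bc tc; apply: GfreeP5.
pose f (i : 'I_5) : G := nth a [:: a; b; t; d; c] i.
have E := (ab, bt, td, dc, far_nadj at', far_nadj ad, far_nadj ac,
           far_nadj bd, far_nadj bc, far_nadj tc).
have N := (negbTE (adj_neq ab), negbTE (adj_neq bt), negbTE (adj_neq td),
  negbTE (adj_neq dc), negbTE (far_neq at'), negbTE (far_neq ad),
  negbTE (far_neq ac), negbTE (far_neq bd), negbTE (far_neq bc),
  negbTE (far_neq tc)).
exists f; split.
  case=> -[|[|[|[|[|//]]]]] ? [] [|[|[|[|[|//]]]]] ? /eqP; rewrite /f /= ?N;
  by [move=> _; apply: val_inj | rewrite // eq_sym N].
by case=> -[|[|[|[|[|//]]]]] ? [] [|[|[|[|[|//]]]]] ?; rewrite /f /= ?adj_irrefl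
  ?E // adj_sym ?E.
Qed.

Section NoDominatingPair.

Hypothesis no_dom : forall x y, exists z, far x z && far y z.
Hypothesis far_edge :
  forall x, exists u v, [/\ far x u, far x v & adj u v].

Lemma no_2K2 a b c d : adj a b -> adj c d ->
  far a c -> far a d -> far b c -> far b d -> False.
Proof.
move=> ab cd ac ad bc bd.
have [t /andP[at' ct]] := no_dom a c.
have bt : adj b t.
  case bt: (far b t); last first.
    case: (nfarP bt) => // bt_eq; rewrite -bt_eq in at'.
    by rewrite adj_far in at'.
  by case: (@no_2K1K2 c t a b) => //; rewrite farC.
have dt : adj d t.
  case dt: (far d t); last first.
    case: (nfarP dt) => // dt_eq; rewrite -dt_eq in ct.
    by rewrite adj_far in ct.
  by case: (@no_2K1K2 a t c d) => //; rewrite farC.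
by apply: (@no_P5 a b c d t) => //; rewrite 1?adj_sym 1?farC.
Qed.

(** Two distinct missed vertices would form, together with [ab], a 2K_2 if adjacent and a 2K_1 + K_2
    if not. *)
Lemma edge_misses_one a b z w : adj a b ->
  far a z -> far b z -> far a w -> far b w -> z = w.
Proof.
move=> ab az bz aw bw; case zw: (far z w).
  by case: (@no_2K1K2 z w a b) => //; rewrite farC.
case: (nfarP zw) => // {}zw.
by case: (@no_2K2 a b z w).
Qed.

(** An edge far from [r] cannot also be far from [x], which yields [s]; then [y] is adjacent to [s],
    as otherwise [r], [y] and the edge [xs] are forbidden. *)
Lemma far_common_neighbour r x y : far r x -> far r y -> far x y ->
  exists s, [/\ far r s, adj x s & adj y s].
Proof.
move=> rx ry xy.
have [s rs xs] : exists2 s, far r s & adj x s.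
  have [u [v [ru rv uv]]] := far_edge r.
  case xu: (far x u); last first.
    by case: (nfarP xu) => [->|]; [exists v | exists u].
  case xv: (far x v); last first.
    by case: (nfarP xv) => [->|]; [exists u; rewrite // adj_sym | exists v].
  by case: (@no_2K1K2 r x u v).
exists s; split=> //; case ys: (far y s).
  by case: (@no_2K1K2 r y x s) => //; rewrite farC.
case: (nfarP ys) => // ys_eq.
by rewrite ys_eq (adj_far xs) in xy.
Qed.

Lemma freezing_pair x y r : far x y -> far x r -> far y r ->
  exists s t, [/\ adj y s, adj x s, far r s, adj s t &
                  [/\ adj x t, adj r t & far y t]].
Proof.
move=> xy xr yr.
have [s [rs xs ys]] : exists s, [/\ far r s, adj x s & adj y s].
  by apply: far_common_neighbour; rewrite // farC.
have [t [yt xt rt]] : exists t, [/\ far y t, adj x t & adj r t].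
  by apply: far_common_neighbour; rewrite // farC.
(* If [s] and [t] are not adjacent, a vertex [z] far from [y] and [t] replaces [t]: a missing edge
   from [z] to [x], [r] or [s] would give a 2K_1 + K_2 with edge [xt], [rt] or [ys]. *)
case st: (far s t); last first.
  exists s, t; split=> //; case: (nfarP st) => // st_eq.
  by rewrite st_eq (adj_far rt) in rs.
have [z /andP[yz tz]] := no_dom y t.
have adjz v : adj v t -> far y v -> adj v z.
  move=> vt yv; case vz: (far v z).
    by case: (@no_2K1K2 y z v t) => //; rewrite farC.
  by case: (nfarP vz) => // vz_eq; rewrite -vz_eq farC adj_far in tz.
exists s, z; split=> //; last by split=> //; apply: adjz; rewrite // farC.
case sz: (far s z).
  by case: (@no_2K1K2 t z y s) => //; rewrite farC.
by case: (nfarP sz) => // sz_eq; rewrite -sz_eq adj_far in yz.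
Qed.

Lemma no_dominating_win (x : G) : connected_graph G -> cops_suffice G 2.
Proof.
move=> Gconn; have [y /andP[xy _]] := no_dom x x.
(* Three moves: to [s], to [t], and the capture. *)
apply: (@cops_force_suffice G 2 3 (pair_cops x y)) => // r.
apply: cops_force_pair => xr yr.
have [s [t [ys xs rs st [xt rt yt]]]] := freezing_pair xy xr yr.
apply: (cops_force_step ys) => r1 _ xr1 sr1.
have {sr1 xr1} -> : r1 = r by apply: (@edge_misses_one x s); rewrite // farC.
apply: (cops_force_step st) => r2 rr2 xr2 tr2.
(* The edge [xt] misses [y], hence nothing else; but [y] is far from [r]. *)
have r2y : r2 = y by apply: (@edge_misses_one x t); rewrite // farC.
case: rr2 => [r2r|rr2].
  by rewrite -r2y r2r /far eqxx in yr.
by rewrite -r2y farC adj_far in yr.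
Qed.

End NoDominatingPair.

Lemma two_cops_suffice : connected_graph G -> cops_suffice G 2.
Proof.
move=> Gconn x.
have [[a [b dom]]|no_dom] := pselect (exists a b, dominating a b).
  exact: dominating_win dom x.
have [[a ind]|no_ind] :=
  pselect (exists a, forall u v, far a u -> far a v -> ~~ adj u v).
  exact: independent_far_win ind x.
apply: (no_dominating_win _ _ x) => // [a b|a].
  apply: contrapT => no; apply: no_dom; exists a, b => z.
  by apply/negP => abz; apply: no; exists z.
apply: contrapT => no; apply: no_ind; exists a => u v au av.
by apply/negP => uv; apply: no; exists u, v.
Qed.

End TwoCops.

Theorem theorem6p2p1 (G : sgraph)
  (Gconn : connected_graph G)
  (GfreeP5 : free_of G (path_graph 5))
  (Gfree2K1K2 : free_of G
     (disjoint_union (copies 2 (complete_graph 1)) (complete_graph 2))) :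
  cop_number G <= 2.
Proof.
rewrite /cop_number; case: ex_minnP => m _; apply.
exact/asboolP/two_cops_suffice.
Qed.
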